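(* For every fixed (finite) graph $G$ with chromatic number at most $3$, $\lim_{r\to\infty}\pi(G(r))=0$.
   Context: For a graph $G=(V,E)$ and an integer $r\ge 2$, the $r$-augmentation $G(r)$ of $G$ is the $r$-uniform hypergraph with vertex set $V\cup S$ and edge set $\{e\cup S: e\in E\}$, where $S$ is a set with $S\cap V=\emptyset$ and $|S|=r-2$. For a fixed $r$-uniform hypergraph $F$, $ex(n,F)$ denotes the maximum possible number of edges in an $r$-uniform hypergraph on $n$ vertices that contains no copy of $F$ (as a not necessarily induced subhypergraph), and the Turán density of $F$ is $\pi(F)=\lim_{n\to\infty} ex(n,F)/\binom{n}{r}$ (this limit always exists). *)

(* Defs.v *)
From mathcomp Require Import all_boot all_order all_algebra.
From mathcomp Require Import all_classical all_reals all_analysis.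

Set Implicit Arguments.
Unset Strict Implicit.
Unset Printing Implicit Defensive.

Import Order.TTheory GRing.Theory Num.Theory.
Import numFieldNormedType.Exports.

Local Open Scope nat_scope.

(* A hypergraph with vertex set a finType T is given by its edge set
   E : {set {set T}}; isolated vertices are allowed. A finite simple graph is a
   2-uniform hypergraph. *)
Definition uniform (T : finType) (r : nat) (E : {set {set T}}) : bool :=
  [forall e in E, #|e| == r].

Definition proper_colouring (V : finType) (E : {set {set V}}) (k : nat)
    (c : {ffun V -> 'I_k}) : bool :=
  [forall x, forall y, (x != y) && ([set x; y]%SET \in E) ==> (c x != c y)].

Definition colourable (V : finType) (E : {set {set V}}) (k : nat) : bool :=
  [exists c : {ffun V -> 'I_k}, proper_colouring E c].

Lemma ex_colourable (V : finType) (E : {set {set V}}) :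
  exists k, colourable E k.
Proof.
exists #|V|; apply/existsP; exists [ffun x => enum_rank x].
apply/forallP => x; apply/forallP => y; apply/implyP => /andP[xy _].
by rewrite !ffunE (inj_eq enum_rank_inj).
Qed.

Definition chromatic_number (V : finType) (E : {set {set V}}) : nat :=
  ex_minn (ex_colourable E).

(* The vertex set is the disjoint union of V and S = 'I_(r - 2); the subtraction
   is truncated, so only r >= 2 is meaningful. *)
Definition augmentation (V : finType) (E : {set {set V}}) (r : nat) :
    {set {set (V + 'I_(r - 2))%type}} :=
  [set (inl @: e :|: inr @: [set: 'I_(r - 2)])%SET | e : {set V} in E]%SET.

Definition contains_copy (T U : finType) (F : {set {set T}})
    (H : {set {set U}}) : bool :=
  [exists f : {ffun T -> U}, injectiveb f && [forall e in F, (f @: e)%SET \in H]].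

(* If no r-uniform hypergraph on n vertices avoids F, which forces F to have no
   edge, the value is 0. *)
Definition ex (T : finType) (r : nat) (F : {set {set T}}) (n : nat) : nat :=
  \max_(H : {set {set 'I_n}} | uniform r H && ~~ contains_copy F H) #|H|.

Local Open Scope ring_scope.
Local Open Scope classical_set_scope.

Definition turan_density (R : realType) (T : finType) (r : nat)
    (F : {set {set T}}) : R :=
  lim (((ex r F n)%:R / 'C(n, r)%:R : R) @[n --> \oo]).

(* Main.v *)
Require Import Defs.
From mathcomp Require Import all_boot zify.

(* Deleting a vertex from an (r+1)-set leaves one of its r-subsets, so if an
   r-graph has density above 3/(r+1) then an (r+1)-set contains more than three
   edges on average, and a positive proportion of these sets contain at least
   three. Three edges X - x, X - y, X - z inside an (r+1)-set X form a triangle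
   xyz in the link graph of S = X - {x,y,z}, so by pigeonhole the link graph of
   some (r-2)-set S has at least c n^3 triangles, hence contains K_{t,t,t} for n
   large. Any 3-colourable G embeds in K_{t,t,t}, and S completes it to a copy of
   G(r). Thus the Turan density of G(r) is at most 3/(r+1). *)

(** * Averaging, and complete tripartite boxes in dense ternary relations *)

Lemma exists_subset_card (T : finType) (A : {set T}) (m : nat) :
  m <= #|A| -> exists2 B : {set T}, B \subset A & #|B| = m.
Proof.
rewrite -bin_gt0 -cards_draws => /card_gt0P[B]; rewrite inE => /andP[BA /eqP].
by exists B.
Qed.

Lemma pigeonhole_cover (I T : finType) (Q : {set I}) (B : {set T})
    (C : I -> {set T}) :
    0 < #|B| -> (forall y, y \in B -> exists2 i, i \in Q & y \in C i) ->
  exists2 i, i \in Q & #|B| <= #|Q| * #|C i|.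
Proof.
move=> B0 BC.
have BsumC : #|B| <= \sum_(i in Q) #|C i|.
  apply: (@leq_trans #|\bigcup_(i in Q) C i|).
    apply/subset_leq_card/subsetP => y /BC[i iQ yC].
    by apply/bigcupP; exists i.
  elim/big_rec2: _ => [|i m U _ Um]; first by rewrite cards0.
  by rewrite (leq_trans (leq_card_setU _ _)) ?leq_add2l.
have [/existsP[i /andP[iQ iC]]|/existsPn noi] :=
  boolP [exists i, (i \in Q) && (#|B| <= #|Q| * #|C i|)]; first by exists i.
have [i iQ _] : exists2 i, i \in Q & true.
  by have [y /BC[i iQ _]] := card_gt0P B0; exists i.
have Q0 : 0 < #|Q| by apply/card_gt0P; exists i.
suff : \sum_(j in Q) #|Q| * #|C j| <= #|Q| * #|B|.-1.
  by rewrite -big_distrr /= leq_pmul2l //; lia.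
rewrite -sum_nat_const; apply: leq_sum => j jQ.
by have := noi j; rewrite jQ /= -ltnNge; lia.
Qed.

(** The points outside the counted set contribute at most half of the guaranteed total
    [b * #|T| / k]. The other half comes from points contributing at most [b] each, so there are at
    least [#|T| / (2 * k)] of them. *)
Lemma card_half_average (T : finType) (f : T -> nat) (b k : nat) :
    0 < b -> (forall x, f x <= b) -> b * #|T| <= k * \sum_x f x ->
  #|T| <= 2 * k * #|[set x | b <= 2 * k * f x]|.
Proof.
move=> b0 fb; set S := [set x | _].
have S1 : \sum_(x in S) f x <= #|S| * b.
  by rewrite -sum_nat_const; apply: leq_sum.
have S2 : 2 * k * \sum_(x in ~: S) f x <= #|~: S| * b.
  rewrite big_distrr -sum_nat_const /=; apply: leq_sum => x.
  by rewrite !inE -ltnNge => /ltnW.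
have -> : \sum_x f x = \sum_(x in S) f x + \sum_(x in ~: S) f x.
  rewrite (bigID (mem S)) /=; congr (_ + _).
  by apply: eq_bigl => x; rewrite in_setC.
have := cardsC S; move: S1 S2; move: (\sum_(_ in _) _) (\sum_(_ in _) _) => u v.
move: #|S| #|~: S| => s s' uS vS <- H.
by rewrite -(leq_pmul2l b0); nia.
Qed.

(* First choose [m] vertices of [X] of large degree; since [m] does not depend on
   [X] and [Y], the pigeonhole principle on the subsets of these [m] vertices
   loses only a constant factor. *)
Lemma common_neighbours (t k : nat) (X Y : finType) (P : X -> Y -> bool)
    (m := 4 * k * t) : 0 < t -> 0 < k -> 2 * k * m <= #|X| ->
    #|X| * #|Y| <= k * \sum_x #|[set y | P x y]| ->
  exists2 A : {set X}, #|A| = t &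
    #|Y| <= 4 * k * 2 ^ m * #|[set y | [forall x in A, P x y]]|.
Proof.
move=> t0 k0 mX dP.
have m0 : 0 < m by rewrite /m; nia.
have [Y0|Y0] := posnP #|Y|.
  have [|A _ At] := @exists_subset_card X setT t; last by exists A; rewrite ?Y0.
  by rewrite cardsT (leq_trans _ mX) // /m; nia.
have := @card_half_average _ (fun x => #|[set y | P x y]|) _ k Y0
  (fun x => max_card _).
rewrite mulnC => /(_ dP); set D := [set x | _] => XD.
have [|X0 X0D X0m] := @exists_subset_card _ D m; first nia.
pose f y := #|[set x in X0 | P x y]|.
have fE : \sum_(x in X0) #|[set y | P x y]| = \sum_y f y.
  under eq_bigr do rewrite cardsE -sum1_card.
  under [RHS]eq_bigr do rewrite /f cardsE -sum1_card.
  by rewrite (exchange_big_dep xpredT) //=; apply: eq_bigr.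
have fm y : f y <= m.
  rewrite -X0m subset_leq_card //; apply/subsetP => x.
  by rewrite inE => /andP[].
(* Every vertex of [X0] has degree at least [#|Y| / (2 * k)], so [f] averages at least
   [m / (2 * k)]. Half of this is [m / (4 * k) = t], which is why [m] is [4 * k * t]. *)
pose Y1 := [set y | m <= 2 * (2 * k) * f y].
have YY1 : #|Y| <= 2 * (2 * k) * #|Y1|.
  apply: card_half_average => //.
  rewrite -fE -{1}X0m -sum_nat_const big_distrr /=; apply: leq_sum => x.
  by move=> /(subsetP X0D); rewrite inE.
pose C (A : {set X}) := [set y | [forall x in A, P x y]].
pose Q := [set A in powerset X0 | #|A| == t].
have Q2 : #|Q| <= 2 ^ m.
  rewrite -X0m -card_powerset subset_leq_card //.
  by apply/subsetP => A; rewrite inE => /andP[].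
have [||A] := @pigeonhole_cover _ _ Q Y1 C.
- by move: (leq_trans Y0 YY1); rewrite muln_gt0 => /andP[].
- move=> y; rewrite inE => fy.
  have [|A AX At] := @exists_subset_card _ [set x in X0 | P x y] t.
    by rewrite -/(f y) /m in fy *; nia.
  exists A.
    rewrite !inE At eqxx andbT; apply: subset_trans AX _.
    by apply/subsetP => x; rewrite inE => /andP[].
  rewrite inE; apply/forallP => x; apply/implyP => /(subsetP AX).
  by rewrite inE => /andP[].
rewrite inE => /andP[_ /eqP At] YC; exists A => //.
apply: leq_trans YY1 _; rewrite -/(C A).
have -> : 2 * (2 * k) = 4 * k by lia.
rewrite -[leqRHS]mulnA leq_mul2l (leq_trans YC) ?orbT //.
by rewrite leq_mul2r Q2 orbT.
Qed.

(** Two rounds of [common_neighbours]: first between points [x] and pairs [(y, z)], then between [y]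
    and [z] within the pairs common to [A]. Each round costs a constant factor depending on [t] and
    [k] only. The three sets may overlap; uniformity separates them in [augmentation_copy]. *)
Lemma tripartite_box (t k : nat) : 0 < t -> 0 < k -> exists n0, forall T : finType,
    n0 <= #|T| -> forall P : T -> T -> T -> bool,
    #|T| ^ 3 <= k * #|[set p : T * (T * T) | P p.1 p.2.1 p.2.2]| ->
  exists A B C : {set T}, [/\ #|A| = t, #|B| = t, #|C| = t &
    forall x y z, x \in A -> y \in B -> z \in C -> P x y z].
Proof.
move=> t0 k0; pose k' := 4 * k * 2 ^ (4 * k * t).
pose k'' := 4 * k' * 2 ^ (4 * k' * t).
have k'0 : 0 < k' by rewrite !muln_gt0 k0 expn_gt0.
(* The first two summands meet the size requirements of the two rounds; the third leaves at least
   [t] points in [C0]. *)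
exists (2 * k * (4 * k * t) + 2 * k' * (4 * k' * t) + k'' * t) => T nT P dP.
have [||A At] := @common_neighbours t k T (T * T)%type
    (fun x yz => P x yz.1 yz.2) t0 k0; first lia.
  rewrite card_prod mulnn -expnS (leq_trans dP) // leq_mul2l -!sum1_card.
  rewrite (eq_bigl (fun p : T * (T * T) => xpredT p.1 && P p.1 p.2.1 p.2.2));
    last by move=> p; rewrite inE.
  rewrite -(pair_big_dep xpredT (fun x yz => P x yz.1 yz.2) (fun _ _ => 1)) /=.
  apply/orP; right; apply: leq_sum => x _.
  by rewrite -sum1_card; under [leqRHS]eq_bigl do rewrite inE.
rewrite card_prod -/k'.
set P2 := [set yz | _] => dP2.
have [||B Bt] := @common_neighbours t k' T T
    (fun y z => (y, z) \in P2) t0 k'0; first lia.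
  rewrite (leq_trans dP2) // leq_mul2l -sum1_card.
  rewrite (eq_bigl (fun p : T * T => xpredT p.1 && ((p.1, p.2) \in P2)));
    last by case.
  rewrite -(pair_big_dep xpredT (fun y z => (y, z) \in P2) (fun _ _ => 1)) /=.
  apply/orP; right; apply: leq_sum => x _.
  by rewrite -sum1_card; under [leqRHS]eq_bigl do rewrite inE.
rewrite -/k''; set C0 := [set z | _] => dC.
have k''0 : 0 < k'' by rewrite /k'' muln_gt0 expn_gt0 muln_gt0 k'0.
have [|C CC0 Ct] := @exists_subset_card _ C0 t.
  by rewrite -(leq_pmul2l k''0); lia.
exists A, B, C; split=> // x y z xA yB /(subsetP CC0).
rewrite inE => /forallP/(_ y)/implyP/(_ yB); rewrite inE.
by move=> /forallP/(_ x)/implyP/(_ xA).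
Qed.

(** * Embedding the augmentation of a coloured graph *)

Lemma colourable_chromatic_number (V : finType) (E : {set {set V}}) (k : nat) :
  chromatic_number E <= k -> colourable E k.
Proof.
rewrite /chromatic_number; case: ex_minnP => m /existsP[c /forallP cE] _ mk.
apply/existsP; exists [ffun x => widen_ord mk (c x)].
apply/forallP => x; apply/forallP => y; rewrite !ffunE.
by have /forallP/(_ y) := cE x.
Qed.

(** Each colour class is sent into its part and the added vertices onto [S]. Disjointness comes from
    uniformity: [[set x; y] :|: S] has [s.+2] elements, so [x] and [y] are distinct and outside [S].
    As [1 < k], every part has another one to be paired with. *)
Lemma augmentation_copy (V U : finType) (E : {set {set V}}) (H : {set {set U}})
    (s k : nat) (S : {set U}) (c : {ffun V -> 'I_k}) (part : 'I_k -> {set U}) :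
    1 < k -> uniform 2 E -> proper_colouring E c -> uniform s.+2 H -> #|S| = s ->
    (forall i, #|V| <= #|part i|) ->
    (forall i j x y, i != j -> x \in part i -> y \in part j ->
      [set x; y] :|: S \in H) ->
  contains_copy (augmentation E s.+2) H.
Proof.
move=> k1 /forall_inP E2 /forallP cP /forall_inP Hr cS partV partH.
have card_s2 : s.+2 - 2 = #|S| by rewrite cS; lia.
have cross i j x y : i != j -> x \in part i -> y \in part j ->
    (x != y) && (x \notin S).
  move=> ij xi yj; have := Hr _ (partH _ _ _ _ ij xi yj).
  rewrite -setUA !cardsU1 !inE cS => /eqP; case: eqP; case: (x \in S) => //=;
  case: (y \in S) => /=; lia.
have [i0 [i1 i01]] : exists i0 i1 : 'I_k, i0 != i1.
  by exists (Ordinal (ltnW k1)), (Ordinal k1).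
have other (i : 'I_k) : exists j, i != j.
  by have [->|] := eqVneq i i0; [exists i1|exists i0].
(* Ranks are taken in all of [V], so vertices of the same colour get distinct places in their part;
   [cross] separates different colours. *)
pose g v := enum_val (widen_ord (partV (c v)) (enum_rank v)).
have gP v : g v \in part (c v) by apply: enum_valP.
have gS v : g v \notin S.
  have [j ij] := other (c v).
  have /card_gt0P[y yj] : 0 < #|part j|.
    by apply: leq_trans (partV j); apply/card_gt0P; exists v.
  by have /andP[] := cross _ _ _ _ ij (gP v) yj.
have g_inj : injective g.
  move=> u v guv; have [cuv|cuv] := eqVneq (c u) (c v); last first.
    by have := cross _ _ _ _ cuv (gP u) (gP v); rewrite guv eqxx.
  move: guv; rewrite /g; move: (partV _) (partV _); rewrite cuv => p q.
  by move=> /enum_val_inj/(congr1 val)/= /val_inj/enum_rank_inj.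
pose h (i : 'I_(s.+2 - 2)) := enum_val (cast_ord card_s2 i).
have h_inj : injective h by move=> i j /enum_val_inj/cast_ord_inj.
have hS : h @: setT = S.
  apply/eqP; rewrite eqEcard card_imset // cardsT card_ord [leqRHS]card_s2 leqnn andbT.
  by apply/subsetP => _ /imsetP[i _ ->]; apply: enum_valP.
pose f : {ffun (V + 'I_(s.+2 - 2)) -> U} :=
  [ffun x => match x with inl v => g v | inr i => h i end].
apply/existsP; exists f; apply/andP; split.
  apply/injectiveP => -[u|i] [v|j]; rewrite !ffunE => fuv.
  - by rewrite (g_inj _ _ fuv).
  - by have := gS u; rewrite fuv enum_valP.
  - by have := gS v; rewrite -fuv enum_valP.
  - by rewrite (h_inj _ _ fuv).
apply/forall_inP => _ /imsetP[e eE ->].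
have -> : f @: (inl @: e :|: inr @: setT) = g @: e :|: S.
  rewrite imsetU -!imset_comp -hS; congr (_ :|: _); apply: eq_imset => x;
  by rewrite /= ffunE.
have [u [v [uv eEuv]]] := cards2P _ (E2 e eE).
rewrite eEuv imsetU1 imset_set1; apply: partH (gP u) (gP v).
by have /forallP/(_ v) := cP u; rewrite uv -eEuv eE.
Qed.

(** * Link graphs with many triangles *)

(** Triples are ordered, to form a ternary relation for [tripartite_box]. If [H] is uniform of rank
    [#|S| + 2], membership forces three distinct vertices outside [S]. *)
Definition link_triangles {U : finType} (H : {set {set U}}) (S : {set U}) :
    {set U * (U * U)} :=
  [set p | [&& [set p.1; p.2.1] :|: S \in H, [set p.1; p.2.2] :|: S \in H
             & [set p.2.1; p.2.2] :|: S \in H]].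

(** Double count of the pairs of an edge [h] and a vertex [x] outside it, matched with the pairs of
    [X = x |: h] and its deleted vertex [x]. *)
Lemma sum_deleted_edges (U : finType) (H : {set {set U}}) (r : nat) :
    uniform r H ->
  \sum_(X : {set U} | #|X| == r.+1) #|[set x in X | X :\ x \in H]| =
  #|H| * (#|U| - r).
Proof.
move=> /forall_inP Hr; rewrite -sum_nat_const.
transitivity (\sum_(h in H) \sum_(x | x \notin h) 1); last first.
  apply: eq_bigr => h hH; rewrite sum1dep_card.
  have := cardsC h; rewrite (eqP (Hr h hH)) => <-; rewrite addKn.
  by apply: eq_card => x; rewrite !inE.
under [LHS]eq_bigr do rewrite -sum1_card.
rewrite (exchange_big_dep xpredT) // [RHS](exchange_big_dep xpredT) //=.
apply: eq_bigr => x _.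
rewrite (reindex_onto (fun h => x |: h) (fun X => X :\ x)) /=; last first.
  by move=> X; rewrite inE => /and3P[_ xX _]; rewrite setD1K.
apply: eq_bigl => h; have [xh|xh] := boolP (x \in h).
  by rewrite andbF; apply: contraTF xh => /andP[_ /eqP<-]; rewrite !inE eqxx.
rewrite inE setU1K // eqxx !andbT !inE eqxx /= cardsU1 xh add1n eqSS.
by have [hH|] := boolP (h \in H); rewrite ?andbF // Hr.
Qed.

Lemma binS3 (n s : nat) :
  s.+3 * s.+2 * s.+1 * 'C(n, s.+3) = (n - s.+2) * (n - s.+1) * (n - s) * 'C(n, s).
Proof.
have -> : s.+3 * s.+2 * s.+1 * 'C(n, s.+3) =
  s.+2 * s.+1 * (s.+3 * 'C(n, s.+3)) by lia.
rewrite mul_bin_left.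
have -> : s.+2 * s.+1 * ((n - s.+2) * 'C(n, s.+2)) =
  (n - s.+2) * s.+1 * (s.+2 * 'C(n, s.+2)) by lia.
rewrite mul_bin_left.
have -> : (n - s.+2) * s.+1 * ((n - s.+1) * 'C(n, s.+1)) =
  (n - s.+2) * (n - s.+1) * (s.+1 * 'C(n, s.+1)) by lia.
by rewrite mul_bin_left mulnA.
Qed.

Lemma rich_link (U : finType) (H : {set {set U}}) (s : nat) :
    uniform s.+2 H -> 2 * s.+2 <= #|U| ->
    3 * 'C(#|U|, s.+2) < #|H| * s.+3 ->
  exists2 S : {set U}, #|S| = s &
    #|U| ^ 3 <= 8 * s.+3 ^ 2 * s.+2 * s.+1 * #|link_triangles H S|.
Proof.
move=> Hr nr dH; set n := #|U| in nr dH *.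
pose D (X : {set U}) := [set x in X | X :\ x \in H].
pose W := [set X : {set U} | (#|X| == s.+3) && (2 < #|D X|)].
have sumD : \sum_(X : {set U} | #|X| == s.+3) #|D X| <=
    2 * 'C(n, s.+3) + s.+3 * #|W|.
  have -> : 2 * 'C(n, s.+3) = \sum_(X : {set U} | #|X| == s.+3) 2.
    by rewrite -card_draws sum_nat_const mulnC cardsE.
  have -> : s.+3 * #|W| = \sum_(X : {set U} | #|X| == s.+3)
      if 2 < #|D X| then s.+3 else 0.
    by rewrite -big_mkcondr sum_nat_const mulnC cardsE.
  rewrite -big_split; apply: leq_sum => /= X Xs.
  have [_|] := ltnP; last lia.
  rewrite (leq_trans _ (leq_addl _ _)) // -(eqP Xs) subset_leq_card //.
  by apply/subsetP => x; rewrite inE => /andP[].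
(* The density hypothesis makes the average of [#|D X|] exceed 3, while sets outside [W] contribute
   at most 2 each. *)
have Wn : 'C(n, s.+3) <= s.+3 * #|W|.
  have ns : 0 < n - s.+2 by lia.
  suff : 3 * 'C(n, s.+3) < #|H| * (n - s.+2).
    by move: sumD; rewrite sum_deleted_edges // -/n; lia.
  rewrite -(@ltn_pmul2l s.+3) // mulnCA mul_bin_left.
  by move: dH; rewrite -(ltn_pmul2l ns); lia.
have W0 : 0 < #|W|.
  have : 0 < 'C(n, s.+3) by rewrite bin_gt0; lia.
  by move=> /leq_trans/(_ Wn); rewrite muln_gt0.
(* The sets [X] obtained by adding to [S] a triangle of its link. Those with [#|S| = s] cover [W],
   and [C S] has at most as many members as there are ordered triangles. *)
pose C S := [set [set p.1; p.2.1; p.2.2] :|: S | p in link_triangles H S].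
have [X|S] := @pigeonhole_cover _ _ [set S : {set U} | #|S| == s] W C W0.
  rewrite inE => /andP[/eqP Xs /card_gt2P[x [y [z [[]]]]]].
  rewrite !inE => /andP[xX Hx] /andP[yX Hy] /andP[zX Hz] [xy yz zx].
  have xyzX : [set x; y; z] \subset X.
    by apply/subsetP => u; rewrite !inE => /orP[/orP[]|] /eqP->.
  have xyz3 : #|[set x; y; z]| = 3.
    by rewrite -setUA !cardsU1 cards1 !inE negb_or xy yz [x == z]eq_sym zx.
  exists (X :\: [set x; y; z]).
    by rewrite inE cardsD (setIidPr xyzX) xyz3 Xs; lia.
  (* Adding [S] to two of the three vertices gives [X] minus the third, so three deletions that
     leave edges are the three sides of a triangle. *)
  have XE u v w : u \in X -> v \in X -> u != w -> v != w ->
      [set x; y; z] = [set u; v; w] ->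
      [set u; v] :|: (X :\: [set x; y; z]) = X :\ w.
    move=> uX vX uw vw ->; apply/setP => a; rewrite !inE.
    case: (eqVneq a u) => [->|au]; first by rewrite uw uX.
    case: (eqVneq a v) => [->|av]; first by rewrite vw vX.
    by [].
  apply/imsetP; exists (x, (y, z)) => /=; last first.
    by rewrite -{1}(setID X [set x; y; z]) (setIidPr xyzX).
  rewrite inE /= (XE x y z) // ?(XE x z y) // ?(XE y z x) //; first by apply/and3P.
  - by rewrite eq_sym.
  - by apply/setP => u; rewrite !inE; case: (u == x) (u == y) (u == z) => -[] [].
  - by rewrite eq_sym.
  - by apply/setP => u; rewrite !inE; case: (u == x) (u == y) (u == z) => -[] [].
  - by rewrite eq_sym.
rewrite inE card_draws => /eqP Ss WS; exists S => //.
have {}WS : #|W| <= 'C(n, s) * #|link_triangles H S|.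
  by apply: leq_trans WS _; rewrite leq_mul2l leq_imset_card orbT.
have Cs : 0 < 'C(n, s) by rewrite bin_gt0; lia.
(* As [2 * s.+2 <= n], each factor is at least [n / 2], whence the 8. In the final constant one
   [s.+3] comes from [Wn], and [s.+3 * s.+2 * s.+1] from [binS3]. *)
have n3 : n ^ 3 <= 8 * ((n - s.+2) * (n - s.+1) * (n - s)).
  have -> : n ^ 3 = n * n * n by rewrite !expnS expn0 muln1 mulnA.
  have -> : 8 * ((n - s.+2) * (n - s.+1) * (n - s)) =
      2 * (n - s.+2) * (2 * (n - s.+1)) * (2 * (n - s)) by lia.
  by rewrite !leq_mul //; lia.
rewrite -(leq_pmul2r Cs).
apply: leq_trans (_ : 8 * (s.+3 * s.+2 * s.+1 * 'C(n, s.+3)) <= _).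
  by rewrite binS3 ?mulnA ?leq_mul2r -?mulnA ?n3 ?orbT // mulnA; lia.
have {Wn WS} := leq_trans Wn (leq_mul (leqnn s.+3) WS).
move=> /(leq_mul (leqnn (8 * (s.+3 * s.+2 * s.+1)))).
rewrite -mulnA => /leq_trans; apply.
by rewrite !expnS expn0 muln1; apply: eq_leq; lia.
Qed.

(** * Bounds on the extremal number and the Turán density *)

Lemma ex_augmentation_le (V : finType) (E : {set {set V}}) (s : nat) :
    uniform 2 E -> colourable E 3 ->
  exists n0, forall n, n0 <= n ->
    ex s.+2 (augmentation E s.+2) n * s.+3 <= 3 * 'C(n, s.+2).
Proof.
(* The successor keeps [t] positive even for empty [V], so the parts of the box are nonempty. *)
move=> E2 /existsP[c cE]; pose t := #|V|.+1.
pose k := 8 * s.+3 ^ 2 * s.+2 * s.+1.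
have [||n0 box] := @tripartite_box t k; rewrite // ?muln_gt0 //.
exists (n0 + 2 * s.+2) => n nn; rewrite -leq_divRL //.
apply/bigmax_leqP => H /andP[Hr]; rewrite leq_divRL // leqNgt; apply: contra => dH.
have [||S Ss TS] := @rich_link 'I_n H s Hr; rewrite ?card_ord //; first lia.
pose P x y z := (x, (y, z)) \in link_triangles H S.
have [||A [B [C [At Bt Ct ABC]]]] := box 'I_n _ P; rewrite ?card_ord; first lia.
  rewrite card_ord in TS; apply: leq_trans TS _; rewrite leq_mul2l.
  by rewrite subset_leq_card ?orbT //; apply/subsetP => -[x [y z]]; rewrite [in X in _ -> X]in_set.
pose part (i : 'I_3) := nth set0 [:: A; B; C] i.
apply: (@augmentation_copy _ _ _ _ s 3 S c part) => //.
  by move=> [[|[|[|]]]] //= i; rewrite /part /= (At, Bt, Ct).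
(* A point of the third part completes each cross pair to a triple of the box, so the pair is a side
   of a triangle in the link of [S]. *)
have /card_gt0P[a aA] : 0 < #|A| by rewrite At.
have /card_gt0P[b bB] : 0 < #|B| by rewrite Bt.
have /card_gt0P[z zC] : 0 < #|C| by rewrite Ct.
have AB x y : x \in A -> y \in B -> [set x; y] :|: S \in H.
  by move=> xA yB; have := ABC x y z xA yB zC; rewrite /P inE => /and3P[].
have AC x y : x \in A -> y \in C -> [set x; y] :|: S \in H.
  by move=> xA yC; have := ABC x b y xA bB yC; rewrite /P inE => /and3P[].
have BC x y : x \in B -> y \in C -> [set x; y] :|: S \in H.
  by move=> xB yC; have := ABC a x y aA xB yC; rewrite /P inE => /and3P[].
move=> [[|[|[|]]]] //= ? [[|[|[|]]]] //= ? x y _; rewrite /part /=; auto;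
by rewrite (setUC [set x]); auto.
Qed.

From mathcomp Require Import all_order all_algebra.
From mathcomp Require Import all_classical all_reals all_analysis.
Import Order.TTheory GRing.Theory Num.Theory.
Import numFieldNormedType.Exports.
Local Open Scope ring_scope.
Local Open Scope classical_set_scope.

Lemma turan_density_augmentation (R : realType) (V : finType) (E : {set {set V}})
    (s : nat) : uniform 2 E -> colourable E 3 ->
  0 <= turan_density R s.+2 (augmentation E s.+2) <= 3 / s.+3%:R.
Proof.
move=> E2 cE; rewrite /turan_density; set u := fun n : nat => _ / _.
(* [lim] has the junk value [point = 0] on divergent sequences, so convergence of
   the densities need not be established. *)
have [cu|/dvgP ->] := pselect (cvg (u @ \oo)); last first.
  by rewrite (_ : point = 0 :> R) // lexx divr_ge0.
have [n0 exn] := ex_augmentation_le V E s E2 cE.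
apply/andP; split.
  by apply: limr_ge => //; apply: nearW => n; rewrite divr_ge0.
apply: limr_le => //; near=> n.
have n0n : (n0 <= n)%N by near: n; exact: nbhs_infty_ge.
have sn : (s.+2 <= n)%N by near: n; exact: nbhs_infty_ge.
have Cn : 0 < 'C(n, s.+2)%:R :> R by rewrite ltr0n bin_gt0.
rewrite /u ler_pdivrMr // mulrAC ler_pdivlMr // -!natrM ler_nat.
exact: exn.
Unshelve. all: by end_near.
Qed.

Theorem proposition1p4 (R : realType) (V : finType) (E : {set {set V}})
    (simpleE : uniform 2 E) (chiE : (chromatic_number E <= 3)%N) :
  turan_density R r (augmentation E r) @[r --> \oo] --> (0 : R).
Proof.
have cE := colourable_chromatic_number _ _ _ chiE.
(* The shift leaves only ranks [s.+2], where the truncated subtraction in [augmentation] is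
   exact. *)
rewrite -(cvg_shiftn 2) /=.
have c3 : (3 / s.+3%:R : R) @[s --> \oo] --> (0 : R).
  rewrite -[X in _ --> X](mulr0 3); apply: cvgMr.
  (* The harmonic sequence has terms [1 / n.+1]; shifted by 2 it becomes [1 / s.+3]. *)
  have := @cvg_harmonic R; rewrite -(cvg_shiftn 2).
  by under eq_fun do rewrite addn2.
apply: squeeze_cvgr (cvg_cst 0) c3; apply: nearW => s.
by rewrite addn2 turan_density_augmentation.
Qed.
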